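(* Let $G$ be a finite nilpotent group. Then for every irreducible complex representation $\rho:G\to GL(V)$ there exists $v\in S(V)$ such that $\alpha(\rho)=|G(v)|$.
   Context: All representations are finite-dimensional complex unitary representations. For a representation $\rho:G\to GL(V)$ of a finite group $G$, let $S(V)$ be the unit sphere of $V$ and $G(x)$ the $G$-orbit of $x$. The $\alpha$-characteristic of $\rho$ is $\alpha(\rho):=\gcd\{|G(x)| : x\in S(V)\}$. *)

(* Defs.v *)
From mathcomp Require Import all_boot all_order all_algebra all_fingroup.
From mathcomp Require Import all_solvable mxrepresentation finmap.
From mathcomp Require Import boolp classical_sets reals.
From mathcomp.real_closed Require Import complex.

Set Implicit Arguments.
Unset Strict Implicit.
Unset Printing Implicit Defensive.

Import Order.TTheory GRing.Theory Num.Theory.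
Local Open Scope ring_scope.
Local Open Scope complex_scope.

(* The gcd of a possibly infinite set of natural numbers, namely the nonnegative
   generator of the ideal it spans; it is 0 if A has no nonzero element.
   Such a number exists and is unique, see is_gcd_setP and is_gcd_set_uniq. *)
Definition is_gcd_set (A : set nat) (d : nat) : Prop :=
  (forall a, A a -> (d %| a)%N) /\
  (forall e, (forall a, A a -> (e %| a)%N) -> (e %| d)%N).

Definition gcd_set (A : set nat) : nat := xget 0%N (is_gcd_set A).

Lemma is_gcd_set_uniq (A : set nat) (d e : nat) :
  is_gcd_set A d -> is_gcd_set A e -> d = e.
Proof.
by move=> [dA dmax] [eA emax]; apply/eqP; rewrite eqn_dvd emax // dmax.
Qed.

Lemma is_gcd_setP (A : set nat) : is_gcd_set A (gcd_set A).
Proof.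
suff [d dP] : exists d, is_gcd_set A d by exact: (xgetPex 0%N (ex_intro _ d dP)).
have [[a [Aa a_gt0]]|A0] := pselect (exists a, A a /\ (0 < a)%N); last first.
  exists 0%N; split=> [a Aa|e _]; last exact: dvdn0.
  by case: a Aa => // a Aa; case: A0; exists a.+1.
pose P k := `[< exists b, A b /\ gcdn a b = k >].
exists (\big[gcdn/0%N]_(k < a.+1 | P k) k); split=> [b Ab|e eA].
  have lt_ab : (gcdn a b < a.+1)%N by rewrite ltnS dvdn_leq ?dvdn_gcdl.
  have Pab : P (Ordinal lt_ab) by apply/asboolP; exists b.
  rewrite (bigD1 (Ordinal lt_ab)) //=.
  exact: dvdn_trans (dvdn_gcdl _ _) (dvdn_gcdr a b).
apply: (big_ind (fun d => (e %| d)%N)); first exact: dvdn0.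
- by move=> x y ex ey; rewrite dvdn_gcd ex ey.
- by move=> k /asboolP[b [Ab <-]]; rewrite dvdn_gcd !eA.
Qed.

(* Matrix representations act on row vectors from the right, x |-> x *m rG g. *)
Section AlphaCharacteristic.
Variables (R : realType) (gT : finGroupType) (G : {group gT}) (n : nat).
Variable rG : mx_representation R[i] G n.

(* Unitarity is with respect to the standard Hermitian product dotmx. *)
Definition unitary_repr : Prop := forall g, g \in G -> rG g \is unitarymx.

Definition unit_sphere : set 'rV[R[i]]_n :=
  [set x : 'rV[R[i]]_n | dotmx x x = 1]%classic.

Definition repr_orbit (x : 'rV[R[i]]_n) : {fset 'rV[R[i]]_n} :=
  [fset x *m rG g | g in G]%fset.

Definition alpha_char : nat :=
  gcd_set [set #|` repr_orbit x | | x in unit_sphere]%classic.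

End AlphaCharacteristic.

Arguments unit_sphere : clear implicits.

(* Main.v *)
(** Take a nonzero v whose stabilizer S has maximal order; it suffices that the
    order of every other stabilizer T divides |S|.  Fix a prime p.  The p-part of
    T and the p'-part of S lie in commuting factors of G = O_p(G) x O_p'(G) and
    each fixes a nonzero vector, so by irreducibility they have a common nonzero
    fixed vector.  Its stabilizer has order at least |T|_p |S|_p', and maximality
    of |S| gives |T|_p <= |S|_p. *)

Require Import Defs.
From mathcomp Require Import all_boot all_order all_algebra all_fingroup.
From mathcomp Require Import all_solvable mxrepresentation finmap.
From mathcomp Require Import boolp classical_sets reals.
From mathcomp.real_closed Require Import complex.

Set Implicit Arguments.
Unset Strict Implicit.
Unset Printing Implicit Defensive.

Local Open Scope ring_scope.
Local Open Scope complex_scope.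

Import Order.TTheory GRing.Theory Num.Theory.

Lemma irr_common_fixed_vector (F : fieldType) (gT : finGroupType)
    (G A B H K : {group gT}) (n : nat) (rG : mx_representation F G n)
    (u w : 'rV[F]_n) :
    mx_irreducible rG -> (#|K|%:R != 0 :> F) -> (A \x B)%g = G ->
    H \subset A -> K \subset B -> u != 0 -> w != 0 ->
    H \subset rstab rG u -> K \subset rstab rG w ->
  exists2 z : 'rV[F]_n, z != 0 & (H <*> K)%g \subset rstab rG z.
Proof.
move=> irrG K_neq0 defG sHA sKB u_neq0 w_neq0 Hu Kw.
have [_ defAB cAB _] := dprodP defG.
have [nsAG nsBG] := dprod_normal2 defG.
have sAG := normal_sub nsAG; have sBG := normal_sub nsBG.
have sHG := fintype.subset_trans sHA sAG.
have sKG := fintype.subset_trans sKB sBG.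
(* E commutes with A and maps onto vectors fixed by K.  Some translate u g is not
   killed by E, since these span and w E = |K| w; writing g = b a, the vector
   (u b) E is the one sought. *)
pose E : 'M[F]_n := \sum_(k in K) rG k.
have EK k : k \in K -> E *m rG k = E.
  move=> Kk; rewrite mulmx_suml [RHS](reindex_inj (mulIg k)) /=.
  apply: eq_big => [x|x Kx]; first by rewrite groupMr.
  by rewrite repr_mxM // (fintype.subsetP sKG).
have EA a : a \in A -> rG a *m E = E *m rG a.
  move=> Aa; rewrite mulmx_suml mulmx_sumr; apply: eq_bigr => k Kk.
  have Gk := fintype.subsetP sKG k Kk; have Ga := fintype.subsetP sAG a Aa.
  by rewrite -!repr_mxM // (centsP cAB k (fintype.subsetP sKB k Kk) a Aa).
have wE : w *m E != 0.
  suff -> : w *m E = #|K|%:R *: w by rewrite scaler_eq0 negb_or K_neq0.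
  rewrite mulmx_sumr -sumr_const scaler_suml; apply: eq_bigr => k Kk.
  by have := fintype.subsetP Kw k Kk; rewrite inE scale1r => /andP[_ /eqP].
clearbody E.
have [g Gg ugE] : exists2 g, g \in G & u *m rG g *m E != 0.
  apply/exists_inP; apply: contraNT wE; rewrite negb_exists_in => /forall_inP uE0.
  have [_ /(_ _ (cyclic_mx_module rG u))] := (mx_irrP rG).1 irrG.
  rewrite cyclic_mx_eq0 => /(_ u_neq0) u_full.
  have /cyclic_mxP[_ /envelop_mxP[c ->] ->] := submx_full w u_full.
  rewrite mulmx_sumr mulmx_suml big1 // => x Gx.
  by rewrite -scalemxAr -scalemxAl (eqP (negbNE (uE0 x Gx))) scaler0.
have /mulsgP[a b Aa Bb def_g] : g \in (A * B)%g by rewrite defAB.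
move: ugE; rewrite {}def_g {g Gg}.
have Ga := fintype.subsetP sAG a Aa; have Gb := fintype.subsetP sBG b Bb.
rewrite -(centsP cAB b Bb a Aa) repr_mxM // mulmxA -mulmxA EA // mulmxA => ubEa.
exists (u *m rG b *m E).
  by apply: contraNneq ubEa => ->; rewrite mul0mx.
(* Elements of [H] lie in [A], so they move left past [E] and [b] until they meet [u], which they
   fix. Elements of [K] are absorbed by [E] on the right. *)
rewrite join_subG; apply/andP; split; apply/fintype.subsetP=> x Xx; rewrite inE.
  have Ax := fintype.subsetP sHA x Xx; have Gx := fintype.subsetP sHG x Xx.
  rewrite Gx /= -(mulmxA _ E) -EA // mulmxA -(mulmxA u) -repr_mxM //.
  rewrite (centsP cAB b Bb x Ax) repr_mxM // !mulmxA.
  by have := fintype.subsetP Hu x Xx; rewrite inE => /andP[_ /eqP->].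
by rewrite (fintype.subsetP sKG) //= -(mulmxA _ E) EK.
Qed.

(** Orbit-stabilizer: [x *m rG g] depends only on the right coset of the stabilizer containing [g],
    and distinct cosets give distinct vectors. *)
Lemma card_repr_orbit (R : realType) (gT : finGroupType) (G : {group gT})
    (n : nat) (rG : mx_representation R[i] G n) (x : 'rV[R[i]]_n) :
  #|` repr_orbit rG x|%N = #|G : rstab rG x|%g.
Proof.
have repr_cosetP g : g \in G ->
    exists2 s, s \in rstab rG x & repr (rstab rG x :* g)%g = (s * g)%g.
  by move=> Gg; have /rcosetP[s Ss ->] := mem_repr_rcoset (rstab_group rG x) g; exists s.
have xM s g : s \in rstab rG x -> g \in G -> x *m rG (s * g)%g = x *m rG g.
  by rewrite inE => /andP[Gs /eqP xs] Gg; rewrite repr_mxM // mulmxA xs.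
(* Indexing the orbit by coset representatives instead of all of [G] makes the parametrization
   injective, so it can be counted. *)
have -> : repr_orbit rG x =
    [fset x *m rG (repr C) | C in rcosets (rstab rG x) G]%fset.
  apply/fsetP=> y; apply/imfsetP/imfsetP => -[/= g Gg ->].
    exists (rstab rG x :* g)%g; first by rewrite /= mem_rcosets mulSGid ?rstab_sub.
    by have [s Ss ->] := repr_cosetP g Gg; rewrite xM.
  have /rcosetsP[h Gh ->] := Gg.
  by exists h => //; have [s Ss ->] := repr_cosetP h Gh; rewrite xM.
rewrite card_in_imfset /=; first by rewrite -cardE.
move=> _ _ /rcosetsP[g Gg ->] /rcosetsP[h Gh ->].
have [s Ss ->] := repr_cosetP g Gg; have [t St ->] := repr_cosetP h Gh.
rewrite !xM // => xgh; apply: rcoset_eqP; rewrite mem_rcoset inE groupM ?groupV //=.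
by rewrite repr_mxM ?groupV // mulmxA xgh repr_mxK.
Qed.

Lemma unit_sphere_neq0 (R : realType) (n : nat) (x : 'rV[R[i]]_n) :
  unit_sphere R n x -> x != 0.
Proof.
rewrite /unit_sphere /=; apply: contra_eq_neq => ->.
by rewrite linear0l eq_sym oner_neq0.
Qed.

Lemma unit_sphere_scaled (R : realType) (n : nat) (x : 'rV[R[i]]_n) :
  x != 0 -> exists2 c : R[i], c != 0 & unit_sphere R n (c *: x).
Proof.
move=> x_neq0; have x_gt0 : 0 < dotmx x x by rewrite dnorm_gt0.
exists (sqrtC (dotmx x x))^-1; first by rewrite invr_eq0 sqrtC_eq0 gt_eqF.
rewrite /unit_sphere /= linearZl_LR linearZr_LR /= mulrA -normCK.
rewrite normfV ger0_norm ?sqrtC_ge0 ?(ltW x_gt0) // exprVn sqrtCK.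
by rewrite mulVf ?gt_eqF.
Qed.

Lemma rstab_scale (F : fieldType) (gT : finGroupType) (G : {group gT}) (n : nat)
    (rG : mx_representation F G n) (c : F) (x : 'rV[F]_n) :
  c != 0 -> rstab rG (c *: x) = rstab rG x.
Proof.
move=> c_neq0; apply/setP=> g; rewrite !inE -scalemxAl.
by rewrite (inj_eq (scalerI c_neq0)).
Qed.

Lemma dvdn_rstab_max (F : numFieldType) (gT : finGroupType) (G : {group gT})
    (n : nat) (rG : mx_representation F G n) (v w : 'rV[F]_n) :
    nilpotent G -> mx_irreducible rG -> v != 0 -> w != 0 ->
    (forall z : 'rV[F]_n, z != 0 -> (#|rstab rG z| <= #|rstab rG v|)%N) ->
  (#|rstab rG w| %| #|rstab rG v|)%N.
Proof.
move=> nilG irrG v_neq0 w_neq0 vmax.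
have sSG := rstab_sub rG v; have sTG := rstab_sub rG w.
set S := rstab_group rG v; set T := rstab_group rG w.
have nilS : nilpotent S := nilpotentS sSG nilG.
have nilT : nilpotent T := nilpotentS sTG nilG.
have hallG pi := nilpotent_pcore_Hall pi nilG.
apply/dvdn_partP => [|p pT]; first exact: (cardG_gt0 T).
(* In a nilpotent group each pi-core is a normal Hall subgroup, hence contains every pi-subgroup. *)
have sHA : 'O_p(T)%g \subset 'O_p(G)%g.
  by rewrite (sub_normal_Hall (hallG _)) ?pcore_normal ?pcore_pgroup //
    (fintype.subset_trans (pcore_sub _ _)).
have sKB : 'O_p^'(S)%g \subset 'O_p^'(G)%g.
  by rewrite (sub_normal_Hall (hallG _)) ?pcore_normal ?pcore_pgroup //
    (fintype.subset_trans (pcore_sub _ _)).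
(* Here [w] is fixed by the p-part of [T] and [v] by the p'-part of [S]. The order of the latter is
   nonzero in [F] by characteristic zero. *)
have [|z z_neq0 HKz] := irr_common_fixed_vector irrG _ (nilpotent_pcoreC p nilG)
  sHA sKB w_neq0 v_neq0 (pcore_sub _ _) (pcore_sub _ _).
  by rewrite pnatr_eq0 -lt0n cardG_gt0.
have := leq_trans (subset_leq_card HKz) (vmax z z_neq0).
have [_ _ cAB _] := dprodP (nilpotent_pcoreC p nilG).
have cHK : 'O_p^'(S)%g \subset 'C('O_p(T))%g.
  exact: fintype.subset_trans sKB (fintype.subset_trans cAB (centS sHA)).
have coHK : coprime #|'O_p(T)%g| #|'O_p^'(S)%g|.
  exact: pnat_coprime (pcore_pgroup _ _) (pcore_pgroup _ _).
(* The two parts commute and have coprime orders, so the order of their join is the product; the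
   p'-part of [|S|] then cancels. *)
rewrite cent_joinEr // coprime_cardMg //.
rewrite (card_Hall (nilpotent_pcore_Hall _ nilT)).
rewrite (card_Hall (nilpotent_pcore_Hall _ nilS)).
rewrite -[X in (_ <= X)%N -> _](partnC p (cardG_gt0 S)) leq_pmul2r ?part_gt0 //.
move=> leTS; apply: dvdn_trans (dvdn_part p #|S|); move: leTS.
(* Both sides are powers of [p], for which the inequality amounts to divisibility. *)
rewrite !p_part; case: (leqP (logn p #|T|) (logn p #|S|)) => [/dvdn_exp2l-> //|lt_ST].
by rewrite leqNgt ltn_exp2l ?lt_ST ?prime_gt1 //; move: pT; rewrite mem_primes => /andP[].
Qed.

Theorem proposition3p19 (R : realType) (gT : finGroupType) (G : {group gT})
    (nilG : nilpotent G) (n : nat) (rG : mx_representation R[i] G n)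
    (unitG : unitary_repr rG) (irrG : mx_irreducible rG) :
  exists v : 'rV[R[i]]_n,
    unit_sphere R n v /\ alpha_char rG = #|` repr_orbit rG v|%N.
Proof.
have [v v_neq0 vmax] : exists2 v : 'rV[R[i]]_n, v != 0 &
    (forall z : 'rV[R[i]]_n, z != 0 -> (#|rstab rG z| <= #|rstab rG v|)%N).
  pose P k := `[< exists2 v : 'rV[R[i]]_n, v != 0 & #|rstab rG v| = k >].
  have exP : exists k, P k.
    (* Any nonzero vector would do; the all-ones vector is nonzero because irreducibility forces
       [n > 0]. *)
    exists #|rstab rG (const_mx 1 : 'rV_n)|; apply/asboolP; exists (const_mx 1) => //.
    have [n_gt0 _] := (mx_irrP rG).1 irrG.
    apply/eqP=> /rowP/(_ (Ordinal n_gt0)); rewrite !mxE; exact/eqP/oner_neq0.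
  have ubP k : P k -> (k <= #|G|)%N.
    by move/asboolP=> [v _ <-]; rewrite subset_leq_card ?rstab_sub.
  case: (ex_maxnP exP ubP) => k /asboolP[v v_neq0 <-] kmax.
  by exists v => // z z_neq0; apply: kmax; apply/asboolP; exists z.
have [c c_neq0 cvS] := unit_sphere_scaled v_neq0.
(* An orbit size dividing all the others is their gcd, being itself a member of the set. *)
exists (c *: v); split=> //; apply: is_gcd_set_uniq (is_gcd_setP _) _.
split=> [_ [x xS <-]|e]; last by apply; exists (c *: v).
rewrite !card_repr_orbit rstab_scale //.
have x_neq0 := unit_sphere_neq0 xS.
have dvd_st := dvdn_rstab_max nilG irrG v_neq0 x_neq0 vmax.
(* By Lagrange, order times index is [|G|] for both stabilizers, so divisibility of the orders
   reverses to divisibility of the indices. *)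
rewrite -(@dvdn_pmul2l #|rstab rG x|); last exact: (cardG_gt0 (rstab_group rG x)).
rewrite (Lagrange (rstab_sub rG x)) -(Lagrange (rstab_sub rG v)).
by rewrite dvdn_mul.
Qed.
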